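(* Let $a:\mathbb R\to\mathbb R$ be a bounded $\mathcal C^\infty$ function which is zero on $\mathbb R^{-}=(-\infty,0]$ and satisfies $a(s)\neq 0$ for all $s>0$. Put $r=\sqrt{x^2+y^2}$, $A(z,r)=\frac{a(r^2-z^2)}{r^2}$, $f=xA(z,r)$ and $g=-yA(z,r)$. Let $\alpha$ be the Lie group action of $SL(2,\mathbb R)$ on $\mathbb R^3$ (with coordinates $(x,y,z)$) generated by the vector fields $$\overline X=\rho(X)+fR,\qquad \overline Y=\rho(Y)+gR,\qquad \overline Z=\rho(Z),$$ where $$\rho(X)=y\frac{\partial}{\partial z}+z\frac{\partial}{\partial y},\quad \rho(Y)=x\frac{\partial}{\partial z}+z\frac{\partial}{\partial x},\quad \rho(Z)=x\frac{\partial}{\partial y}-y\frac{\partial}{\partial x},\quad R=x\frac{\partial}{\partial x}+y\frac{\partial}{\partial y}+z\frac{\partial}{\partial z}.$$ Let $\hat\alpha$ be the lifted action of $SL(2,\mathbb R)$ on $T^*(\mathbb R^3)$. Then $\hat\alpha$ is Hamiltonian and is not $\mathcal C^\infty$-linearizable.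
   Context: The functions $f$ and $g$ are extended by $0$ to the points where $r=0$ (where $r^2-z^2\le 0$, so $a(r^2-z^2)=0$). Here $X,Y,Z$ is a basis of $\mathfrak{sl}(2,\mathbb R)$ with $[X,Y]=-Z$, $[Z,X]=Y$, $[Z,Y]=-X$. The vector fields $\overline X,\overline Y,\overline Z$ are complete, satisfy these same bracket relations, and integrate to an action of $SL(2,\mathbb R)$ on $\mathbb R^3$ fixing the origin; this is the action $\alpha$. For a Lie group action $\alpha: G\times M\to M$, the lifted (cotangent lift) action on $T^*M$ is $\hat\alpha_g(\beta)=(\alpha_{g^{-1}})^*(\beta)$ for $\beta\in T^*M$, so that it covers $\alpha_g$. The cotangent bundle carries the symplectic form $\omega=d\theta$, where $\theta$ is the Liouville one-form $\langle\theta_p,v\rangle=\langle p,d\pi_p(v)\rangle$ for $p\in T^*M$, $v\in T_p(T^*M)$, $\pi:T^*M\to M$ the projection. ''Hamiltonian'' means Hamiltonian with respect to $\omega$, i.e. admitting a moment map $T^*M\to\mathfrak g^*$. ''$\mathcal C^\infty$-linearizable'' refers to the fixed point $0\in T^*(\mathbb R^3)$ (the zero covector over the origin of $\mathbb R^3$): it means that there exist $\mathcal C^\infty$ local coordinates in a neighbourhood of this fixed point in which the vector fields generating the action are simultaneously linear (have homogeneous linear coefficients in the coordinates). *)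

(* Defs.v *)
From HB Require Import structures.
From mathcomp Require Import all_boot all_order all_algebra.
From mathcomp Require Import all_classical all_reals all_analysis.

Set Implicit Arguments.
Unset Strict Implicit.
Unset Printing Implicit Defensive.

Import Order.TTheory GRing.Theory Num.Theory.
Import numFieldNormedType.Exports.

Local Open Scope classical_set_scope.
Local Open Scope ring_scope.

(* All the spaces V and W used below are finite dimensional; there, requiring
   Frechet differentiability together with C^k directional derivatives is the
   usual notion of a C^(k+1) map. *)
Fixpoint Ck_on (R : realType) (V W : normedModType R) (k : nat) (U : set V)
    (f : V -> W) : Prop :=
  match k with
  | 0 => forall x, U x -> {for x, continuous f}
  | k'.+1 => (forall x, U x -> differentiable f x) /\
             (forall v : V, Ck_on k' U (fun x => 'D_v f x))
  end.

Definition smooth_on (R : realType) (V W : normedModType R) (U : set V)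
    (f : V -> W) : Prop := forall k, Ck_on k U f.

(* Smoothness along an arbitrary subset A of V (in the application, an embedded
   submanifold): f is locally the restriction to A of a smooth map. *)
Definition smooth_along (R : realType) (V W : normedModType R) (A : set V)
    (f : V -> W) : Prop :=
  forall x, A x -> exists (U : set V) (F : V -> W),
    [/\ open U, U x, smooth_on U F & forall y, U y -> A y -> F y = f y].

Definition SL2 (R : realType) : set 'M[R]_2 := [set g | \det g = 1].

Definition sl2 (R : realType) : {vspace 'M[R]_2} :=
  lker (linfun (fun A : 'M[R]_2 => \tr A : R^o)).

Definition lie_bracket (R : realType) (A B : 'M[R]_2) : 'M[R]_2 :=
  A *m B - B *m A.

Definition sl2_basis (R : realType) (X Y Z : 'M[R]_2) : Prop :=
  [/\ basis_of (sl2 R) [:: X; Y; Z],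
      lie_bracket X Y = - Z, lie_bracket Z X = Y & lie_bracket Z Y = - X].

Definition expmx (R : realType) (A : 'M[R]_2) : 'M[R]_2 :=
  limn (series (fun k : nat => (k`!%:R)^-1 *: A ^+ k)).

(* A left action of SL(2,R) on M; the values of act outside SL(2,R) are
   irrelevant. *)
Definition lie_group_action (R : realType) (M : normedModType R)
    (act : 'M[R]_2 -> M -> M) : Prop :=
  [/\ forall m, act 1%:M m = m,
      forall g h m, SL2 g -> SL2 h -> act (g *m h) m = act g (act h m)
    & smooth_along (@SL2 R `*` [set: M]) (fun gm : 'M[R]_2 * M => act gm.1 gm.2)].

(* The vector field associated with xi.  For a left action it is the sign in
   exp(- t xi) that makes xi |-> fund_field act xi a morphism of Lie algebras
   (rather than an anti-morphism) for the bracket of vector fields. *)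
Definition fund_field (R : realType) (M : normedModType R)
    (act : 'M[R]_2 -> M -> M) (xi : 'M[R]_2) (m : M) : M :=
  'D_1 (fun t : R => act (expmx (- (t *: xi))) m) 0.

Definition pairing (R : realType) (p v : 'rV[R]_3) : R :=
  \sum_(i < 3) p 0 i * v 0 i.

(* T^*(R^3): the pair (q, p) is the covector v |-> pairing p v at q. *)
Definition cotangent (R : realType) : normedModType R :=
  ('rV[R]_3 * 'rV[R]_3)%type.

(* phi^* beta, for beta a covector at phi q, as a covector at q. *)
Definition pullback (R : realType) (phi : 'rV[R]_3 -> 'rV[R]_3)
    (q p : 'rV[R]_3) : 'rV[R]_3 :=
  \row_i pairing p ('D_(delta_mx 0 i) phi q).

Definition cotangent_lift (R : realType)
    (act : 'M[R]_2 -> 'rV[R]_3 -> 'rV[R]_3)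
    (g : 'M[R]_2) (b : cotangent R) : cotangent R :=
  (act g b.1, pullback (act (invmx g)) (act g b.1) b.2).

Definition liouville (R : realType) (b v : cotangent R) : R :=
  pairing b.2 ('D_v (fun c : cotangent R => c.1) b).

(* Exterior derivative of a one-form on a vector space (u and v are extended
   to constant, hence commuting, vector fields). *)
Definition ext_d (R : realType) (M : normedModType R) (theta : M -> M -> R)
    (x u v : M) : R :=
  'D_u (fun y => theta y v) x - 'D_v (fun y => theta y u) x.

Definition omega (R : realType) : cotangent R -> cotangent R -> cotangent R -> R :=
  ext_d (@liouville R).

(* J b is an element of the dual of sl(2,R); its values outside sl(2,R) are
   irrelevant. *)
Definition moment_map (R : realType)
    (act : 'M[R]_2 -> cotangent R -> cotangent R)
    (J : cotangent R -> 'M[R]_2 -> R) : Prop :=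
  [/\ forall b (c : R) xi eta, xi \in sl2 R -> eta \in sl2 R ->
        J b (c *: xi + eta) = c * J b xi + J b eta,
      forall xi, xi \in sl2 R -> smooth_on setT (fun b => J b xi),
      forall xi, xi \in sl2 R -> forall b v,
        omega b (fund_field act xi b) v = 'D_v (fun c => J c xi) b
    & forall g, SL2 g -> forall b xi, xi \in sl2 R ->
        J (act g b) xi = J b (invmx g *m xi *m g)].

Definition hamiltonian (R : realType)
    (act : 'M[R]_2 -> cotangent R -> cotangent R) : Prop :=
  exists J, moment_map act J.

Definition local_coordinates (R : realType) (x0 : cotangent R)
    (U : set (cotangent R)) (phi : cotangent R -> 'rV[R]_6) : Prop :=
  [/\ open U, U x0, smooth_on U phi
    & exists (W : set 'rV[R]_6) (psi : 'rV[R]_6 -> cotangent R),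
      [/\ open W, smooth_on W psi,
          forall x, U x -> W (phi x) /\ psi (phi x) = x
        & forall w, W w -> U (psi w) /\ phi (psi w) = w]].

(* 'D_(v x) phi x is the expression in the coordinates phi of the vector field
   v at the point x. *)
Definition smoothly_linearizable (R : realType)
    (act : 'M[R]_2 -> cotangent R -> cotangent R) (x0 : cotangent R) : Prop :=
  exists (U : set (cotangent R)) (phi : cotangent R -> 'rV[R]_6),
    local_coordinates x0 U phi /\
    forall xi, xi \in sl2 R -> exists L : 'M[R]_6,
      forall x, U x -> 'D_(fund_field act xi x) phi x = phi x *m L.

Definition vec3 (R : realType) (x y z : R) : 'rV[R]_3 := \row_i [:: x; y; z]`_i.

Definition coord_x (R : realType) (q : 'rV[R]_3) : R := q 0 (inord 0).
Definition coord_y (R : realType) (q : 'rV[R]_3) : R := q 0 (inord 1).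
Definition coord_z (R : realType) (q : 'rV[R]_3) : R := q 0 (inord 2).

Definition radius (R : realType) (q : 'rV[R]_3) : R :=
  Num.sqrt (coord_x q ^+ 2 + coord_y q ^+ 2).

Definition Acoef (R : realType) (a : R -> R) (z r : R) : R :=
  a (r ^+ 2 - z ^+ 2) / r ^+ 2.

Definition fcoef (R : realType) (a : R -> R) (q : 'rV[R]_3) : R :=
  if radius q == 0 then 0 else coord_x q * Acoef a (coord_z q) (radius q).
Definition gcoef (R : realType) (a : R -> R) (q : 'rV[R]_3) : R :=
  if radius q == 0 then 0 else - coord_y q * Acoef a (coord_z q) (radius q).

(* Vector fields on R^3 are given by their coefficients on d/dx, d/dy, d/dz. *)
Definition rhoX (R : realType) (q : 'rV[R]_3) : 'rV[R]_3 :=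
  vec3 0 (coord_z q) (coord_y q).
Definition rhoY (R : realType) (q : 'rV[R]_3) : 'rV[R]_3 :=
  vec3 (coord_z q) 0 (coord_x q).
Definition rhoZ (R : realType) (q : 'rV[R]_3) : 'rV[R]_3 :=
  vec3 (- coord_y q) (coord_x q) 0.

Definition radial (R : realType) (q : 'rV[R]_3) : 'rV[R]_3 :=
  vec3 (coord_x q) (coord_y q) (coord_z q).

Definition Xbar (R : realType) (a : R -> R) (q : 'rV[R]_3) : 'rV[R]_3 :=
  rhoX q + fcoef a q *: radial q.
Definition Ybar (R : realType) (a : R -> R) (q : 'rV[R]_3) : 'rV[R]_3 :=
  rhoY q + gcoef a q *: radial q.
Definition Zbar (R : realType) (q : 'rV[R]_3) : 'rV[R]_3 := rhoZ q.

(* Main.v *)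
Require Import Defs.
From HB Require Import structures.
From mathcomp Require Import all_boot all_order all_algebra.
From mathcomp Require Import all_classical all_reals all_analysis.
From mathcomp Require Import ring lra.
Import Order.TTheory GRing.Theory Num.Theory.
Import numFieldNormedType.Exports.
Local Open Scope classical_set_scope.
Local Open Scope ring_scope.

Set Implicit Arguments.
Unset Strict Implicit.
Unset Printing Implicit Defensive.

(** Write xi_M for the vector field on R^3 generated by xi.

    Hamiltonian: the moment map is minus the tautological pairing,
    J(q, p)(xi) = - p(xi_M(q)).  Since omega(u, v) = u_p . v_q - v_p . u_q,
    Hamilton's equations for J(.)(xi) say that the lifted action is generated
    by (xi_M, - p o d(xi_M)).  The base component holds by definition
    ([act_path_field]).  The fibre component is the derivative in t of the
    differential of the inverse flow ([derive_inverse_action]): differentiate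
    a local smooth extension of the action to 'M_2 x R^3 once along the group
    and once along R^3, and exchange the two derivatives ([derive_comm]).
    Working with that extension, rather than with the submanifold SL(2), also
    gives linearity in xi and smoothness of xi_M; it only requires the curve
    exp(- t xi) to stay in SL(2) and to have velocity - xi at t = 0
    ([expmx_sl2]).  Equivariance is the identity
    d(g^-1)(xi_M(g q)) = (Ad(g^-1) xi)_M(q) ([fund_field_equivariant]).

    Not linearizable: the field of X alone is an obstruction.  On the zero
    section over the x-axis the lift of X is a(t^2) d/dx at (t, 0, 0), which
    vanishes at t = 0 together with its first derivative.  In coordinates phi
    in which the field is w |-> w L, this forces phi(0) L = 0 and
    (d phi_0 (d/dx)) L = 0, so that the field vanishes on a whole segment
    through phi(0).  Carried back by phi, the segment is a curve of zeros of
    the lifted field that is tangent to the x-axis at the origin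
    ([zero_curve]).  Close to the origin and apart from it, the base points of
    that curve satisfy |z| < |x|, hence r^2 - z^2 > 0; but there the x-component
    of Xbar is x^2 a(r^2 - z^2) / r^2, which is nonzero ([Xbar_neq0]). *)

(** * Directional derivatives *)

Section Differentials.
Context {R : realType}.
Implicit Types V W : normedModType R.

(** The difference g - f vanishes near x, so its differential is zero there and
    differentiability passes from f to g = f + (g - f). *)
Lemma near_eq_differentiable V W (f g : V -> W) x :
  (\near x, f x = g x) -> differentiable f x -> differentiable g x.
Proof.
move=> fg df; pose h := g - f.
have h0 : h \o shift x = cst (h x) + (0 : V -> W) +o_ 0 id.
  apply/eqaddoP => _/posnumP[e].
  have -> : h x = 0 by rewrite /h !fctE (nbhs_singleton fg) subrr.
  near=> y.
  have fgy : f (y + x) = g (y + x).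
    near: y; rewrite near_simpl.
    have := fg; rewrite (near_shift 0 x) /= subr0.
    by apply: filterS => y /=.
  rewrite /h /= !fctE /= fgy subrr !addr0 ?subr0 normr0.
  by rewrite mulr_ge0.
have c0 : continuous (0 : V -> W) by move=> y; exact: cst_continuous.
have dh0 : 'd h x = 0 :> (V -> W) by exact: diff_unique.
have dh : differentiable h x by apply/diff_locallyP; rewrite dh0.
have -> : g = f + h by rewrite /h addrC subrK.
exact: differentiableD.
Unshelve. all: by end_near. Qed.

Lemma derive_along_curve V W (f : V -> W) (c : R -> V) (t : R) (v : V) :
  differentiable f (c t) -> is_derive t 1 c v ->
  is_derive t 1 (f \o c) ('D_v f (c t)).
Proof.
move=> df [dc cv].
have dc' : differentiable c t by apply/derivable1_diffP.
have dfc : differentiable (f \o c) t by exact: differentiable_comp.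
apply: DeriveDef; first exact: diff_derivable.
by rewrite deriveE// diff_comp//= -(deriveE _ dc') cv -deriveE.
Qed.

Lemma curve_near V (U : set V) (c : R -> V) (t : R) (v : V) :
  is_derive t 1 c v -> open U -> U (c t) -> \forall s \near t, U (c s).
Proof.
move=> [dc _] oU Uct.
have cc : {for t, continuous c}.
  exact/differentiable_continuous/derivable1_diffP.
by apply: cc; exact: open_nbhs_nbhs.
Qed.

Lemma is_derive_pair V W (f : R -> V) (g : R -> W) (t : R) (v : V) (w : W) :
  is_derive t 1 f v -> is_derive t 1 g w ->
  is_derive t 1 (fun s => (f s, g s)) (v, w).
Proof.
move=> [df fv] [dg gw].
have df' : differentiable f t by apply/derivable1_diffP.
have dg' : differentiable g t by apply/derivable1_diffP.
have dfg : differentiable (fun s => (f s, g s)) t by exact: differentiable_pair.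
apply: DeriveDef; first exact: diff_derivable.
by rewrite deriveE// diff_pair//= -(deriveE _ df') -(deriveE _ dg') fv gw.
Qed.

Lemma is_derive_scalel V (k : R -> R) (t dk : R) (v : V) :
  is_derive t 1 k dk -> is_derive t 1 (fun s => k s *: v) (dk *: v).
Proof.
move=> dk'.
have dv : differentiable ( *:%R ^~ v : R -> V) (k t) by exact: ex_diff.
apply: is_derive_eq (derive_along_curve dv dk') _.
by rewrite deriveE// diff_val.
Qed.

Lemma is_derive_line V (x v : V) (t : R) :
  is_derive t 1 (fun s : R => x + s *: v) v.
Proof.
have dx := is_derive_cst x t (1 : R).
have dv := is_derive_scalel v (is_derive_id t (1 : R)).
by apply: is_derive_eq (is_deriveD dx dv) _; rewrite add0r scale1r.
Qed.

Lemma derive_linear V W (f : {linear V -> W}) x v :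
  continuous f -> 'D_v f x = f v.
Proof.
by move=> cf; rewrite deriveE ?diff_lin//; exact: linear_differentiable.
Qed.

Lemma derive_dir_linear V W (f : V -> W) x (k : R) u v :
  differentiable f x -> 'D_(k *: u + v) f x = k *: 'D_u f x + 'D_v f x.
Proof. by move=> df; rewrite !deriveE// linearP. Qed.

(** The two difference quotients are the same function. *)
Lemma derive_affine V V' W (f : V' -> W) (l : {linear V -> V'}) c x v :
  'D_v (fun y => f (c + l y)) x = 'D_(l v) f (c + l x).
Proof.
rewrite /derive; set F := fun _ => _; set G := fun _ => _.
suff -> : F = G by [].
by apply/funext => h; rewrite /F /G /= linearP addrCA.
Qed.

Lemma derive_coord V m n (f : V -> 'M[R]_(m, n)) x v i j : derivable f x v ->
  'D_v (fun y => f y i j) x = ('D_v f x) i j.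
Proof. by move=> df; rewrite derive_mx// mxE. Qed.

End Differentials.

(** * Smooth maps on open sets *)

Section Smoothness.
Context {R : realType}.
Implicit Types V W : normedModType R.

Lemma Ck_on_eq V W k (U : set V) (f g : V -> W) : open U ->
  (forall x, U x -> f x = g x) -> Ck_on k U f -> Ck_on k U g.
Proof.
move=> oU; have nU x : U x -> \forall y \near x, U y.
  by move=> Ux; exact: open_nbhs_nbhs.
elim: k f g => [|k IH] f g fg /=.
  move=> cf x Ux; have := cf _ Ux.
  rewrite /prop_for /continuous_at -fg// => cfx.
  apply: cvg_trans cfx; apply: near_eq_cvg; apply: filterS (nU _ Ux) => y Uy.
  exact: fg.
move=> [df Df]; split.
  move=> x Ux; apply: near_eq_differentiable (df _ Ux).
  by apply: filterS (nU _ Ux) => y Uy; exact: fg.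
move=> v; apply: IH (Df v) => x Ux; apply: near_eq_derive.
by apply: filterS (nU _ Ux) => y Uy; exact: fg.
Qed.

(** All the conditions in [Ck_on k] are conditions at points: this is what makes
    smoothness a local property. *)
Lemma Ck_on_pointwise V W k (A : set V) (f : V -> W) :
  (forall x, A x -> exists2 U : set V, U x & Ck_on k U f) -> Ck_on k A f.
Proof.
elim: k f => [|k IH] f /= H.
  by move=> x /H [U Ux cf]; exact: cf.
split; first by move=> x /H [U Ux [df _]]; exact: df.
by move=> v; apply: IH => x /H [U Ux [_ /(_ v)]]; exists U.
Qed.

Lemma smooth_on_local V W (A : set V) (f : V -> W) :
  (forall x, A x -> exists (U : set V) (g : V -> W),
     [/\ open U, U x, smooth_on U g & forall y, U y -> g y = f y]) ->
  smooth_on A f.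
Proof.
move=> H k; apply: Ck_on_pointwise => x /H [U [g [oU Ux sg gf]]].
by exists U => //; apply: Ck_on_eq gf _.
Qed.

Lemma smooth_on_differentiable V W (U : set V) (f : V -> W) x :
  smooth_on U f -> U x -> differentiable f x.
Proof. by move=> /(_ 1)[+ _] => /[apply]. Qed.

Lemma smooth_on_derive V W (U : set V) (f : V -> W) v :
  smooth_on U f -> smooth_on U ('D_v f).
Proof. by move=> sf k; have [_] := sf k.+1; exact. Qed.

Lemma smooth_on_continuous V W (U : set V) (f : V -> W) x :
  smooth_on U f -> U x -> {for x, continuous f}.
Proof. by move=> /(_ 0)/[apply]. Qed.

Lemma Ck_on_cst V W k (U : set V) (w : W) : Ck_on k U (fun=> w).
Proof.
elim: k w => [|k IH] w /=; first by move=> x _; exact: cst_continuous.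
split=> [x _|v]; first exact: differentiable_cst.
by under eq_fun do rewrite derive_cst; exact: IH.
Qed.

Lemma smooth_on_linear V W (U : set V) (l : {linear V -> W}) :
  continuous l -> smooth_on U l.
Proof.
move=> cl [|k] /=; first by move=> x _; exact: cl.
split=> [x _|v]; first exact: linear_differentiable.
by under eq_fun do rewrite derive_linear//; exact: Ck_on_cst.
Qed.

Lemma smooth_on_affine V V' W (U : set V') (f : V' -> W)
    (l : {linear V -> V'}) c :
  continuous l -> smooth_on U f ->
  smooth_on [set x | U (c + l x)] (fun x => f (c + l x)).
Proof.
move=> cl sf k; elim: k f sf => [|k IH] f sf /=.
  move=> x Ux; apply: (@continuous_comp _ _ _ (fun x => c + l x)).
    by apply: continuousD; [exact: cst_continuous|exact: cl].
  exact: smooth_on_continuous sf _.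
split=> [x Ux|v].
  apply: (@differentiable_comp _ _ _ _ (fun x => c + l x)).
    by apply: differentiableD => //; exact: linear_differentiable.
  exact: smooth_on_differentiable sf _.
have -> : 'D_v (fun y => f (c + l y)) = (fun x => 'D_(l v) f (c + l x)).
  by apply/funext => x; exact: derive_affine.
exact: IH ('D_(l v) f) (smooth_on_derive _ sf).
Qed.

Lemma smooth_on_coord V m n (U : set V) (f : V -> 'M[R]_(m.+1, n.+1)) i j :
  open U -> smooth_on U f -> smooth_on U (fun x => f x i j).
Proof.
move=> oU sf k; elim: k f sf => [|k IH] f sf /=.
  move=> x Ux; apply: (@continuous_comp _ _ _ f (fun M => M i j)); last first.
    exact: coord_continuous.
  exact: smooth_on_continuous sf _.
have df x : U x -> differentiable f x by exact: smooth_on_differentiable.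
split=> [x Ux|v].
  apply: (@differentiable_comp _ _ _ _ f (fun M => M i j)); first exact: df.
  exact: differentiable_coord.
apply: (@Ck_on_eq _ _ _ _ (fun x => 'D_v f x i j)) => // [x Ux|].
  by rewrite derive_coord//; exact/diff_derivable/df.
exact: IH ('D_v f) (smooth_on_derive _ sf).
Qed.

Lemma Ck_onD V W k (U : set V) (f g : V -> W) : open U ->
  Ck_on k U f -> Ck_on k U g -> Ck_on k U (fun x => f x + g x).
Proof.
move=> oU; elim: k f g => [|k IH] f g /=.
  by move=> cf cg x Ux; apply: continuousD; [exact: cf|exact: cg].
move=> [df Df] [dg Dg]; split=> [x Ux|v].
  by apply: differentiableD; [exact: df|exact: dg].
apply: Ck_on_eq (IH _ _ (Df v) (Dg v)) => // x Ux.
by rewrite deriveD//; apply: diff_derivable; [exact: df|exact: dg].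
Qed.

(** The Leibniz rule expresses the derivative of a product of smooth functions
    through products of smooth functions.  The induction is on the order of
    the product only: the factors stay smooth, so their derivatives may be used
    at any order. *)
Lemma smooth_onM V (U : set V) (f g : V -> R) : open U ->
  smooth_on U f -> smooth_on U g -> smooth_on U (fun x => f x * g x).
Proof.
move=> oU + + k; elim: k f g => [|k IH] f g sf sg /=.
  by move=> x Ux; apply: continuousM; [exact: (sf 0%N)|exact: (sg 0%N)].
have df x : U x -> differentiable f x by exact: smooth_on_differentiable.
have dg x : U x -> differentiable g x by exact: smooth_on_differentiable.
split=> [x Ux|v]; first by apply: differentiableM; [exact: df|exact: dg].
have IH1 := IH _ _ sf (smooth_on_derive v sg).
have IH2 := IH _ _ sg (smooth_on_derive v sf).
apply: Ck_on_eq (Ck_onD oU IH1 IH2) => // x Ux.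
by rewrite deriveM//; apply: diff_derivable; [exact: df|exact: dg].
Qed.

Lemma smooth_on_sum V W n (U : set V) (f : 'I_n -> V -> W) : open U ->
  (forall i, smooth_on U (f i)) -> smooth_on U (fun x => \sum_i f i x).
Proof.
move=> oU; elim: n f => [|n IH] f sf k.
  by under eq_fun do rewrite big_ord0; exact: Ck_on_cst.
under eq_fun do rewrite big_ord_recl.
by apply: Ck_onD => //; [exact: sf|apply: IH].
Qed.

End Smoothness.

(** * Symmetry of second derivatives *)

Section Schwarz.
Context {R : realType} {V : normedModType R}.

Lemma mvt_line (f : V -> R) x v (h : R) : 0 <= h ->
  (forall s, 0 <= s <= h -> differentiable f (x + s *: v)) ->
  exists2 s, 0 <= s <= h & f (x + h *: v) - f x = 'D_v f (x + s *: v) * h.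
Proof.
move=> h0 df.
have D s : 0 <= s <= h ->
    is_derive s 1 (fun s : R => f (x + s *: v)) ('D_v f (x + s *: v)).
  move=> /df dfs.
  have Dl := is_derive_line x v s.
  exact: (@derive_along_curve _ _ _ f (fun s => x + s *: v) s v dfs Dl).
have [||s] := @MVT_segment _ (fun s => f (x + s *: v))
  (fun s => 'D_v f (x + s *: v)) 0 h h0.
- by move=> s; rewrite in_itv/= => /andP[/ltW s0 /ltW sh]; apply: D; rewrite s0.
- apply: derivable_within_continuous => s; rewrite in_itv/= => sh.
  by have [] := D s sh.
- by rewrite in_itv/= scale0r addr0 subr0 => sh E; exists s.
Qed.

(** The mean value theorem along u, applied to y |-> f (y + h v) - f y, and then
    along v, applied to D_u f. *)
Lemma second_difference (U : set V) (f : V -> R) x u v (h : R) : 0 <= h ->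
  smooth_on U f ->
  (forall s t, 0 <= s <= h -> 0 <= t <= h -> U (x + s *: u + t *: v)) ->
  exists s t, [/\ 0 <= s <= h, 0 <= t <= h &
    f (x + h *: u + h *: v) - f (x + h *: u) - f (x + h *: v) + f x =
    'D_v ('D_u f) (x + s *: u + t *: v) * h * h].
Proof.
move=> h0 sf Uh.
have hh : 0 <= h <= h by rewrite h0 lexx.
have h00 : 0 <= (0 : R) <= h by rewrite h0 lexx.
have dfU s t : 0 <= s <= h -> 0 <= t <= h ->
    differentiable f (x + s *: u + t *: v).
  by move=> sh th; apply: smooth_on_differentiable sf _; exact: Uh.
have dfU0 s : 0 <= s <= h -> differentiable f (x + s *: u).
  by move=> sh; have := dfU s 0 sh h00; rewrite scale0r addr0.
have dshift y : differentiable f (h *: v + y) ->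
    differentiable (fun y => f (h *: v + y)) y.
  move=> df; apply: (@differentiable_comp _ _ _ _ (fun y => h *: v + y)) => //.
pose g := (fun y => f (h *: v + y)) - f.
have shiftE s : h *: v + (x + s *: u) = x + s *: u + h *: v by rewrite addrC.
have dg s : 0 <= s <= h -> differentiable g (x + s *: u).
  move=> sh; apply: differentiableB; last exact: dfU0.
  by apply: dshift; rewrite shiftE; exact: dfU.
have [s sh gE] := mvt_line h0 dg.
have dgs : 'D_u g (x + s *: u) =
    'D_u f (x + s *: u + h *: v) - 'D_u f (x + s *: u).
  rewrite deriveB; last 2 first.
  - by apply/diff_derivable/dshift; rewrite shiftE; exact: dfU.
  - exact/diff_derivable/dfU0.
  by rewrite (derive_affine f idfun (h *: v)) /= shiftE.
have dDu t : 0 <= t <= h -> differentiable ('D_u f) (x + s *: u + t *: v).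
  move=> th; apply: smooth_on_differentiable (smooth_on_derive u sf) _.
  exact: Uh.
have [t th DE] := mvt_line h0 dDu.
exists s, t; split=> //.
rewrite -DE -dgs -gE /g !fctE shiftE [h *: v + x]addrC.
by rewrite opprB addrA addrAC.
Qed.

Lemma eq_of_nearby_values (p q : V -> R) x :
  {for x, continuous p} -> {for x, continuous q} ->
  (forall r, 0 < r ->
    exists y z, [/\ `|x - y| < r, `|x - z| < r & p y = q z]) ->
  p x = q x.
Proof.
move=> cp cq pq; apply/eqP/negPn/negP => neq.
pose e := `|p x - q x| / 2.
have e0 : 0 < e by rewrite divr_gt0// normr_gt0 subr_eq0.
move/cvgrPdist_lt : cp => /(_ e e0)/nbhs_normP[r1 /= r10 H1].
move/cvgrPdist_lt : cq => /(_ e e0)/nbhs_normP[r2 /= r20 H2].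
have r0 : 0 < Order.min r1 r2 by rewrite lt_min r10.
have [y [z []]] := pq _ r0.
rewrite !lt_min => /andP[/H1/= py _] /andP[_ /H2/= qz].
move=> E; rewrite E in py.
have := ler_distD (q z) (p x) (q x).
rewrite leNgt => /negP; apply.
by rewrite [ltRHS](splitr `|p x - q x|) ltrD// distrC.
Qed.

(** The second difference is symmetric in u and v.  It is therefore h^2 times a
    value of D_v D_u f and h^2 times a value of D_u D_v f, at two points which
    tend to x with h; continuity of both functions concludes. *)
Lemma derive_comm (U : set V) (f : V -> R) x u v : open U -> U x ->
  smooth_on U f -> 'D_u ('D_v f) x = 'D_v ('D_u f) x.
Proof.
move=> oU Ux sf; apply: (@eq_of_nearby_values ('D_u ('D_v f)) ('D_v ('D_u f))).
- exact: smooth_on_continuous (smooth_on_derive u (smooth_on_derive v sf)) Ux.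
- exact: smooth_on_continuous (smooth_on_derive v (smooth_on_derive u sf)) Ux.
move=> r1 r10.
have /nbhs_normP[r2 /= r20 Hr] : \forall y \near x, U y.
  exact: open_nbhs_nbhs.
pose r := Order.min r1 r2; have r0 : 0 < r by rewrite lt_min r10.
pose m := `|u| + `|v| + 1; have m0 : 0 < m by rewrite ltr_wpDl// addr_ge0.
(* The parallelogram at x with sides h u and h v lies in the ball of radius r,
   since s |u| + t |v| <= h m = r / 2 there. *)
pose h := r / (2 * m); have h0 : 0 < h by rewrite divr_gt0// mulr_gt0.
have small s t : 0 <= s <= h -> 0 <= t <= h ->
    `|x - (x + s *: u + t *: v)| < r.
  move=> /andP[s0 sh] /andP[t0 th]; rewrite opprD addrA opprD addrA subrr.
  rewrite add0r -opprD normrN (le_lt_trans (ler_normD _ _))// !normrZ.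
  rewrite (ger0_norm s0) (ger0_norm t0).
  have : s * `|u| + t * `|v| <= h * m.
    by rewrite /m 2!mulrDr mulr1 -[leLHS]addr0 !lerD ?ler_wpM2r// ltW.
  have -> : h * m = r / 2 by rewrite /h invfM mulrA mulfVK// gt_eqF.
  lra.
have small' s t : 0 <= s <= h -> 0 <= t <= h ->
    `|x - (x + s *: v + t *: u)| < r.
  by move=> sh th; rewrite addrAC; exact: small.
have ltr1r y : `|x - y| < r -> `|x - y| < r1.
  by move=> /lt_le_trans; apply; rewrite ge_min lexx.
have ltr2r y : `|x - y| < r -> U y.
  by move=> yr; apply: Hr; apply: (lt_le_trans yr); rewrite ge_min lexx orbT.
have [|s [t [sh th E1]]] :=
    second_difference (ltW h0) sf (x := x) (u := u) (v := v).
  by move=> s t sh th; exact: ltr2r (small s t sh th).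
have [|s' [t' [sh' th' E2]]] :=
    second_difference (ltW h0) sf (x := x) (u := v) (v := u).
  by move=> s' t' sh' th'; exact: ltr2r (small' s' t' sh' th').
exists (x + s' *: v + t' *: u), (x + s *: u + t *: v).
split; [exact: ltr1r (small' s' t' sh' th')|exact: ltr1r (small s t sh th)|].
have hn : h != 0 by rewrite gt_eqF.
rewrite (addrAC x (h *: v)) (addrAC (f _)) in E2.
by apply: (mulIf hn); apply: (mulIf hn); exact: etrans (esym E2) E1.
Qed.

End Schwarz.

(** * The exponential of a traceless 2 x 2 matrix *)

Section Matrices2.
Context {R : realType}.
Implicit Types A B : 'M[R]_2.

Lemma sl2P A : (A \in sl2 R) = (\tr A == 0).
Proof.
by rewrite memv_ker lfunE.
Qed.

Lemma sum_ord2 (F : 'I_2 -> R) : \sum_i F i = F 0 + F 1.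
Proof. by rewrite big_ord_recl big_ord1; congr (_ + F _); exact: val_inj. Qed.

Lemma ord2_case (P : 'I_2 -> Prop) : P 0 -> P 1 -> forall i, P i.
Proof.
move=> P0 P1 [[|[|]] // i2].
  by have <- : 0 = Ordinal i2 by exact: val_inj.
by have <- : 1 = Ordinal i2 by exact: val_inj.
Qed.

Lemma det_mx22 A : \det A = A 0 0 * A 1 1 - A 0 1 * A 1 0.
Proof.
rewrite (expand_det_row _ 0) sum_ord2 /cofactor !det_mx11 !mxE /=.
have -> : lift 0 0 = 1 :> 'I_2 by exact: val_inj.
have -> : lift 1 0 = 0 :> 'I_2 by exact: val_inj.
by rewrite expr0 expr1; ring.
Qed.

Lemma mxtrace22 A : \tr A = A 0 0 + A 1 1.
Proof. exact: sum_ord2. Qed.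

(** Cayley-Hamilton. *)
Lemma mulmx_traceless A : \tr A = 0 -> A *m A = (- \det A) *: 1%:M.
Proof.
rewrite mxtrace22 det_mx22 => /eqP; rewrite addr_eq0 => /eqP trA.
apply/matrixP; apply: ord2_case; apply: ord2_case;
  by rewrite !mxE sum_ord2 trA /=; ring.
Qed.

Lemma det_comb A (c s : R) : \tr A = 0 ->
  \det (c *: 1%:M + s *: A) = c ^+ 2 + \det A * s ^+ 2.
Proof.
rewrite mxtrace22 !det_mx22 !mxE /= => /eqP; rewrite addr_eq0 => /eqP ->; ring.
Qed.

Lemma mul_comb A (c s : R) : \tr A = 0 ->
  (c *: 1%:M + s *: A) *m (c *: 1%:M - s *: A) =
  (c ^+ 2 + \det A * s ^+ 2) *: 1%:M.
Proof.
move=> trA; rewrite mulmxDl !mulmxBr -!scalemxAl -!scalemxAr !mulmx1 !mul1mx.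
rewrite mulmx_traceless// !scalerA addrA (mulrC s) subrK -scalerBl.
by congr (_ *: _); ring.
Qed.

Lemma expmx_comb A B (p r : nat -> R) (P Q : R) :
  (forall k, B ^+ k = p k *: 1%:M - r k *: A) ->
  series (fun k => p k / k`!%:R) @ \oo --> P ->
  series (fun k => r k / k`!%:R) @ \oo --> Q ->
  expmx B = P *: 1%:M - Q *: A.
Proof.
move=> Bk pP rQ; apply: cvg_lim => //.
have -> : series (fun k => (k`!%:R)^-1 *: B ^+ k) =
    (fun n => series (fun k => p k / k`!%:R) n *: 1%:M) \-
    (fun n => series (fun k => r k / k`!%:R) n *: A).
  apply/funext => n; rewrite /series /= !scaler_suml -sumrB.
  by apply: eq_bigr => k _; rewrite Bk scalerBr !scalerA !(mulrC _^-1).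
by apply: cvgB; apply: cvgZr_tmp.
Qed.

(** By Cayley-Hamilton, the powers of - t A are combinations p_k 1 - r_k A, and
    (p_k, r_k) obeys this two-term recurrence. *)
Lemma expmx_rec A (t : R) (p r : nat -> R) (P Q : R) : \tr A = 0 ->
  p 0%N = 1 -> r 0%N = 0 ->
  (forall k, p k.+1 = - (t * \det A * r k)) -> (forall k, r k.+1 = t * p k) ->
  series (fun k => p k / k`!%:R) @ \oo --> P ->
  series (fun k => r k / k`!%:R) @ \oo --> Q ->
  expmx (- (t *: A)) = P *: 1%:M - Q *: A.
Proof.
move=> trA p0 r0 pS rS; apply: expmx_comb; elim=> [|k IH].
  by rewrite expr0 p0 r0 scale1r scale0r subr0.
rewrite exprS IH -[_ * _]/(_ *m _) mulNmx -scalemxAl mulmxBr -!scalemxAr mulmx1.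
rewrite mulmx_traceless// pS rS; apply/matrixP => i j; rewrite !mxE; ring.
Qed.

Lemma cvg_series_comb (x y a b : R) (u v f : nat -> R) :
  (forall k, f k = x * u k + y * v k) ->
  series u @ \oo --> a -> series v @ \oo --> b ->
  series f @ \oo --> x * a + y * b.
Proof.
move=> fE ua vb.
have -> : series f = (fun n => x * series u n) \+ (fun n => y * series v n).
  apply/funext => n; rewrite /series /= !mulr_sumr -big_split /=.
  by apply: eq_bigr => k _.
by apply: cvgD; apply: cvgMl_tmp.
Qed.

Lemma is_derive_scale_arg (f : R -> R) df w :
  is_derive (0 : R) 1 f df -> is_derive (0 : R) 1 (fun t => f (t * w)) (w * df).
Proof.
move=> [df0 Df].
have df0' : differentiable f (0 * w) by rewrite mul0r; apply/derivable1_diffP.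
have D := @derive_along_curve R R R f (fun s => s *: w) 0 (1 *: w) df0'
  (is_derive_scalel w (is_derive_id (0 : R) 1)).
apply: is_derive_eq D _.
rewrite scale0r scale1r -Df; rewrite mul0r in df0'.
by rewrite !deriveE// -[w in LHS]mulr1 -[w * 1]/(w *: 1) linearZ.
Qed.

(** The form that exp(- t A) takes: according to the sign of det A, c t is
    cosh (w t), cos (w t) or 1, and s is the primitive of c vanishing at 0. *)
Definition sl2_curve (c s : R -> R) A (t : R) : 'M[R]_2 :=
  c t *: 1%:M - s t *: A.

(** Since A^2 = - det A, the exponential is hyperbolic, trigonometric or affine
    in t according to the sign of det A.  The closed forms give at once that the
    determinant c^2 + det A s^2 is 1 and that the velocity at 0 is - A. *)
Lemma expmx_sl2 A : \tr A = 0 -> exists c s : R -> R,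
  [/\ forall t, expmx (- (t *: A)) = sl2_curve c s A t,
      forall t, c t ^+ 2 + \det A * s t ^+ 2 = 1,
      c 0 = 1 /\ s 0 = 0,
      is_derive (0 : R) 1 c 0 & is_derive (0 : R) 1 s 1].
Proof.
move=> trA; have [d0|d0|d0] := ltgtP (\det A) 0.
- pose w := Num.sqrt (- \det A).
  have w2 : \det A = - w ^+ 2 by rewrite sqr_sqrtr ?oppr_ge0 ?ltW// opprK.
  have w0 : w != 0 by rewrite gt_eqF// sqrtr_gt0 oppr_gt0.
  exists (fun t => 2^-1 * (expR (t * w) + expR (t * - w))).
  exists (fun t => (2 * w)^-1 * (expR (t * w) - expR (t * - w))); split.
  + move=> t.
    apply: (@expmx_rec _ _ (fun k => ((t * w) ^+ k + (t * - w) ^+ k) / 2)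
      (fun k => ((t * w) ^+ k - (t * - w) ^+ k) / (2 * w))).
    * exact: trA.
    * by rewrite !expr0; field.
    * by rewrite !expr0; field.
    * by move=> k; rewrite !exprS w2; field.
    * by move=> k; rewrite !exprS; field.
    * rewrite mulrDr.
      apply: cvg_series_comb (is_cvg_series_exp_coeff (t * w))
        (is_cvg_series_exp_coeff (t * - w)).
      by move=> k; rewrite /exp_coeff/=; ring.
    * rewrite mulrBr -mulNr.
      apply: cvg_series_comb (is_cvg_series_exp_coeff (t * w))
        (is_cvg_series_exp_coeff (t * - w)).
      by move=> k; rewrite /exp_coeff/=; ring.
  + move=> t; rewrite mulrN expRN w2.
    have : expR (t * w) != 0 by rewrite gt_eqF// expR_gt0.
    by move=> ?; field; exact/andP.
  + by rewrite !mul0r expR0; split; field.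
  + have D1 := is_derive_scale_arg w (is_derive_expR 0).
    have D2 := is_derive_scale_arg (- w) (is_derive_expR 0).
    apply: is_derive_eq (is_deriveZ _ (is_deriveD D1 D2)) _.
    by rewrite mulNr subrr scaler0.
  + have D1 := is_derive_scale_arg w (is_derive_expR 0).
    have D2 := is_derive_scale_arg (- w) (is_derive_expR 0).
    apply: is_derive_eq (is_deriveZ _ (is_deriveB D1 D2)) _.
    by rewrite expR0 !mulr1 -[_ *: _]/(_ * _); field.
- pose w := Num.sqrt (\det A).
  have w2 : \det A = w ^+ 2 by rewrite sqr_sqrtr ?ltW.
  have w0 : w != 0 by rewrite gt_eqF// sqrtr_gt0.
  exists (fun t => cos (t * w)), (fun t => w^-1 * sin (t * w)); split.
  + move=> t.
    apply: (@expmx_rec _ _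
      (fun k => (~~ odd k)%:R * (-1) ^+ k./2 * (t * w) ^+ k)
      (fun k => (odd k)%:R * (-1) ^+ k.-1./2 * (t * w) ^+ k / w)).
    * exact: trA.
    * by rewrite !expr0 !mulr1.
    * by rewrite !mul0r.
    * move=> k; rewrite w2 exprS /= negbK.
      have [ok|] := boolP (odd k); last by rewrite !mul0r mulr0 oppr0.
      case: k ok => // k /= /negPf ok; rewrite exprS.
      by field.
    * move=> k; rewrite exprS /=.
      case: (odd k) => /=; first by rewrite !mul0r mulr0.
      by field.
    * rewrite unlock; exact: (@is_cvg_series_cos_coeff R (t * w)).
    * set f := fun k : nat => _.
      have -> : series f = (fun n => w^-1 * series (sin_coeff (t * w)) n).
        apply/funext => n; rewrite /series /= mulr_sumr; apply: eq_bigr => k _.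
        by rewrite /f /sin_coeff/= !mulrA (mulrC w^-1); ring.
      rewrite unlock; apply: cvgMl_tmp.
      exact: (@is_cvg_series_sin_coeff R (t * w)).
  + move=> t; rewrite w2 -exprMn mulrA divff// mul1r; exact: cos2Dsin2.
  + by rewrite mul0r cos0 sin0 mulr0.
  + apply: is_derive_eq (is_derive_scale_arg w (is_derive_cos 0)) _.
    by rewrite sin0 oppr0 mulr0.
  + have D := is_derive_scale_arg w (is_derive_sin 0).
    apply: is_derive_eq (is_deriveZ _ D) _.
    by rewrite cos0 mulr1 -[_ *: _]/(_ * _) mulVf.
- exists (fun _ => 1), id; split=> //.
  + move=> t.
    apply: (@expmx_rec _ _ (fun k => (k == 0)%:R) (fun k => t * (k == 1%N)%:R)).
    * exact: trA.
    * by [].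
    * by rewrite mulr0.
    * by move=> k; rewrite d0 mulr0 mul0r oppr0.
    * by move=> k.
    * apply: cvg_near_cst; exists 1%N => // -[|n]//= _.
      rewrite /series/= big_nat_recl// big1 ?addr0 ?divr1// => k _.
      by rewrite mul0r.
    * apply: cvg_near_cst; exists 2%N => // -[|[|n]]//= _.
      rewrite /series/= !big_nat_recl// big1 ?addr0; last first.
        by move=> k _; rewrite mulr0 mul0r.
      by rewrite mulr0 mul0r add0r mulr1 divr1.
  + by move=> t; rewrite d0 mul0r addr0 expr1n.
  + exact: is_derive_cst.
  + exact: is_derive_id.
Qed.

End Matrices2.

(** * Partial maps of functions on a product *)

Section Products.
Context {R : realType}.
Implicit Types V W : normedModType R.

Lemma fst_continuous V W : continuous (fst : V * W -> V).
Proof. by move=> [x y]; exact: cvg_fst. Qed.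

Lemma snd_continuous V W : continuous (snd : V * W -> W).
Proof. by move=> [x y]; exact: cvg_snd. Qed.

Lemma is_derive_fst V W (x v : V * W) : is_derive x v fst v.1.
Proof.
split; last by rewrite (@derive_linear R _ _ fst)//; exact: fst_continuous.
by apply: diff_derivable; apply: linear_differentiable; exact: fst_continuous.
Qed.

Lemma is_derive_snd V W (x v : V * W) : is_derive x v snd v.2.
Proof.
split; last by rewrite (@derive_linear R _ _ snd)//; exact: snd_continuous.
by apply: diff_derivable; apply: linear_differentiable; exact: snd_continuous.
Qed.

Definition inr0 V W (y : W) : V * W := (0, y).

Lemma inr0_is_linear V W : linear (@inr0 V W).
Proof.
move=> k x y.
by rewrite /inr0 -[RHS]/(k *: 0 + 0, k *: x + y) scaler0 addr0.
Qed.

HB.instance Definition _ V W :=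
  GRing.isLinear.Build R W (V * W)%type _ (@inr0 V W) (@inr0_is_linear V W).

Lemma inr0_continuous V W : continuous (@inr0 V W).
Proof. by move=> y; apply: cvg_pair => //; exact: cvg_cst. Qed.

Lemma slice_pair V W (x : V) (y : W) : (x, 0) + inr0 V y = (x, y).
Proof. by rewrite /inr0 -[LHS]/(x + 0, 0 + y) addr0 add0r. Qed.

Lemma pair_split V W (u : V) (v : W) : (u, v) = 1 *: (u, 0) + (0, v).
Proof. by rewrite scale1r -[RHS]/(u + 0, 0 + v) addr0 add0r. Qed.

Lemma derive_slice V W W' (F : V * W -> W') x y v :
  'D_v (fun z => F (x, z)) y = 'D_(0, v) F (x, y).
Proof.
have -> : (fun z => F (x, z)) = (fun z => F ((x, 0) + inr0 V z)).
  by apply/funext => z; rewrite slice_pair.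
by rewrite (derive_affine F (@inr0 V W)) slice_pair.
Qed.

Lemma smooth_on_slice V W W' (U : set (V * W)) (F : V * W -> W') x :
  smooth_on U F -> smooth_on [set y | U (x, y)] (fun y => F (x, y)).
Proof.
move=> sF.
have -> : [set y | U (x, y)] = [set y | U ((x, 0) + inr0 V y)].
  by apply/funext => y; rewrite /mkset slice_pair.
have -> : (fun y => F (x, y)) = (fun y => F ((x, 0) + inr0 V y)).
  by apply/funext => y; rewrite slice_pair.
exact: (smooth_on_affine (x, 0) (@inr0_continuous V W) sF).
Qed.

Lemma open_slice V W (U : set (V * W)) x : open U -> open [set y | U (x, y)].
Proof.
move=> oU; apply: (@open_comp _ _ (fun y => (x, y))) => // y _.
by apply: cvg_pair => //; exact: cvg_cst.
Qed.

Lemma derive_comm_mx V m n (U : set V) (f : V -> 'M[R]_(m.+1, n.+1)) x u v :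
  open U -> U x -> smooth_on U f -> 'D_u ('D_v f) x = 'D_v ('D_u f) x.
Proof.
move=> oU Ux sf; apply/matrixP => i j.
have key w w' : ('D_w ('D_w' f) x) i j = 'D_w ('D_w' (fun y => f y i j)) x.
  rewrite -(derive_coord (f := 'D_w' f)); last first.
    exact/diff_derivable/(smooth_on_differentiable (smooth_on_derive _ sf)).
  have nU : \forall y \near x, U y by exact: open_nbhs_nbhs.
  apply: near_eq_derive; apply: filterS nU => y Uy; rewrite derive_coord//.
  exact/diff_derivable/(smooth_on_differentiable sf).
apply: etrans (key u v) (etrans _ (esym (key v u))).
exact: derive_comm u v oU Ux (smooth_on_coord i j oU sf).
Qed.

End Products.

(** * The pairing of covectors and vectors *)

Section Pairing.
Context {R : realType}.

Lemma pairing_linear (p : 'rV[R]_3) (k : R) u v :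
  pairing p (k *: u + v) = k * pairing p u + pairing p v.
Proof.
rewrite /pairing mulr_sumr -big_split; apply: eq_bigr => i _.
rewrite !mxE /=; ring.
Qed.

Lemma is_derive_coord (V : normedModType R) m n (f : V -> 'M[R]_(m, n))
    df x v i j :
  is_derive x v f df -> is_derive x v (fun y => f y i j) (df i j).
Proof.
by move=> [d <-]; split; [exact: (derivable_mxP f x v).1|rewrite derive_coord].
Qed.

Lemma is_derive_pairing (V : normedModType R) (f g : V -> 'rV[R]_3) x v df dg :
  is_derive x v f df -> is_derive x v g dg ->
  is_derive x v (fun y => pairing (f y) (g y))
    (pairing df (g x) + pairing (f x) dg).
Proof.
move=> Df Dg.
have D i := is_deriveM (is_derive_coord 0 i Df) (is_derive_coord 0 i Dg).
have -> : (fun y => pairing (f y) (g y)) =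
    \sum_(i < 3) (fun y => f y 0 i * g y 0 i).
  by apply/funext => y; rewrite /pairing fct_sumE.
apply: is_derive_eq (is_derive_sum D) _.
rewrite /pairing -big_split; apply: eq_bigr => i _ /=.
rewrite /GRing.scale /=; ring.
Qed.

Lemma is_derive_row (f : 'I_3 -> R -> R) df (t : R) :
  (forall i, is_derive t 1 (f i) (df i)) ->
  is_derive t 1 (fun s => \row_i f i s : 'rV[R]_3) (\row_i df i).
Proof.
move=> D.
have fE i j : (fun s => (\row_i f i s : 'rV[R]_3) i j) = f j.
  by apply/funext => s; rewrite mxE.
have d : derivable (fun s => \row_i f i s : 'rV[R]_3) t 1.
  by apply/derivable_mxP => i j; rewrite fE; have [] := D j.
split=> //; rewrite derive_mx//; apply/matrixP => i j; rewrite !mxE fE.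
by have [] := D j.
Qed.

Lemma pairing0l (v : 'rV[R]_3) : pairing 0 v = 0.
Proof. by rewrite /pairing big1// => i _; rewrite mxE mul0r. Qed.

Lemma pairing0r (v : 'rV[R]_3) : pairing v 0 = 0.
Proof. by rewrite /pairing big1// => i _; rewrite mxE mulr0. Qed.

Lemma pairingNr (p v : 'rV[R]_3) : pairing p (- v) = - pairing p v.
Proof.
by rewrite -scaleN1r -[_ *: _]addr0 pairing_linear pairing0r mulN1r addr0.
Qed.

Lemma pairing_rowN (f : 'I_3 -> R) v :
  pairing (\row_i - f i) v = - pairing (\row_i f i) v.
Proof.
by rewrite /pairing -sumrN; apply: eq_bigr => i _; rewrite !mxE mulNr.
Qed.

(** The row of partial derivatives represents the differential, by linearity of
    the latter; this needs f differentiable, not only derivable along the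
    axes. *)
Lemma pairing_derive (f : 'rV[R]_3 -> 'rV[R]_3) x (p v : 'rV[R]_3) :
  differentiable f x ->
  pairing (\row_i pairing p ('D_(delta_mx 0 i) f x)) v = pairing p ('D_v f x).
Proof.
move=> df; rewrite /pairing deriveE// [in RHS](row_sum_delta v) linear_sum.
under [RHS]eq_bigr do rewrite summxE mulr_sumr.
rewrite exchange_big; apply: eq_bigr => i _; rewrite !mxE mulr_suml.
by apply: eq_bigr => j _; rewrite linearZ !mxE deriveE//= mulrAC mulrA.
Qed.

End Pairing.

(** * Curves through the identity of SL(2) *)

Section Paths.
Context {R : realType}.

Definition sl2_path (g : R -> 'M[R]_2) A :=
  [/\ forall t, SL2 (g t), g 0 = 1%:M & is_derive (0 : R) 1 g A].

Lemma SL2_unit (g : 'M[R]_2) : SL2 g -> g \in unitmx.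
Proof. by move=> SLg; rewrite unitmxE SLg unitr1. Qed.

Lemma sl2_curve_path (c s : R -> R) (A : 'M[R]_2) : \tr A = 0 ->
  (forall t, c t ^+ 2 + \det A * s t ^+ 2 = 1) -> c 0 = 1 -> s 0 = 0 ->
  is_derive (0 : R) 1 c 0 -> is_derive (0 : R) 1 s 1 ->
  sl2_path (sl2_curve c s A) (- A).
Proof.
move=> trA cs c0 s0 Dc Ds; split.
- by move=> t; rewrite /SL2/= /sl2_curve -scaleNr det_comb// sqrrN.
- by rewrite /sl2_curve c0 s0 scale1r scale0r subr0.
- have D := is_deriveB (is_derive_scalel 1%:M Dc) (is_derive_scalel A Ds).
  apply: is_derive_eq D _.
  by rewrite scale0r scale1r sub0r.
Qed.

(** The inverse of exp(- t A) is the curve with the same c and s for - A,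
    because (c - s A)(c + s A) = c^2 + det A s^2 = 1. *)
Lemma expmx_path (A : 'M[R]_2) : \tr A = 0 ->
  sl2_path (fun t => expmx (- (t *: A))) (- A) /\
  sl2_path (fun t => invmx (expmx (- (t *: A)))) A.
Proof.
move=> trA; have [c [s [E cs [c0 s0] Dc Ds]]] := expmx_sl2 trA.
under eq_fun do rewrite E.
have P := sl2_curve_path trA cs c0 s0 Dc Ds.
split=> //; under eq_fun do rewrite E.
have trN : \tr (- A) = 0 by rewrite raddfN /= trA oppr0.
have detN : \det (- A) = \det A by rewrite -scaleN1r detZ sqrrN expr1n mul1r.
have := @sl2_curve_path c s (- A) trN.
rewrite detN opprK => /(_ cs c0 s0 Dc Ds).
suff -> : sl2_curve c s (- A) = (fun t => invmx (sl2_curve c s A t)) by [].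
apply/funext => t; have [SLt _ _] := P.
have u := SL2_unit (SLt t).
have M : sl2_curve c s (- A) t *m sl2_curve c s A t = 1%:M.
  by rewrite /sl2_curve scalerN opprK mul_comb// cs scale1r.
by rewrite -[LHS]mulmx1 -(mulmxV u) mulmxA M mul1mx.
Qed.

(** Conjugation preserves trace and determinant, hence acts on the closed form
    of the exponential through A only. *)
Lemma conj_path (g : 'M[R]_2) (A : 'M[R]_2) : SL2 g -> \tr A = 0 ->
  sl2_path (fun t => invmx g *m expmx (- (t *: A)) *m g)
    (- (invmx g *m A *m g)).
Proof.
move=> SLg trA; have u := SL2_unit SLg.
have [c [s [E cs [c0 s0] Dc Ds]]] := expmx_sl2 trA.
have trC : \tr (invmx g *m A *m g) = 0.
  by rewrite mxtrace_mulC mulmxA mulmxV// mul1mx.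
have detC : \det (invmx g *m A *m g) = \det A.
  by rewrite !det_mulmx mulrC mulrA -det_mulmx mulmxV// det1 mul1r.
have := @sl2_curve_path c s _ trC; rewrite detC => /(_ cs c0 s0 Dc Ds).
suff -> : sl2_curve c s (invmx g *m A *m g) =
  (fun t => invmx g *m expmx (- (t *: A)) *m g) by [].
apply/funext => t; rewrite E /sl2_curve mulmxBr mulmxBl -!scalemxAr -!scalemxAl.
by rewrite mulmx1 mulVmx.
Qed.

Lemma SL2_inv (g : 'M[R]_2) : SL2 g -> SL2 (invmx g).
Proof. by move=> SLg; rewrite /SL2/= det_inv SLg invr1. Qed.

Lemma SL2_1 : SL2 (1%:M : 'M[R]_2).
Proof. exact: det1. Qed.

End Paths.

(** * The fundamental vector fields of an action *)

Section Action.
Context {R : realType} {M : normedModType R} (act : 'M[R]_2 -> M -> M).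
Hypothesis actP : lie_group_action act.

(** Smoothness of an action is given as smoothness along the subset SL(2) x M.
    An extension F is defined on an open set, so that it can be differentiated
    in every direction of 'M_2, including those that leave SL(2). *)
Definition smooth_extension (U : set ('M[R]_2 * M)) (F : 'M[R]_2 * M -> M) :=
  [/\ open U, smooth_on U F
    & forall g m, U (g, m) -> SL2 g -> F (g, m) = act g m].

Lemma exists_extension g m : SL2 g ->
  exists U F, smooth_extension U F /\ U (g, m).
Proof.
move=> SLg; have [_ _ /(_ (g, m))] := actP; case=> [//|U [F [oU Ux sF FE]]].
by exists U, F; split=> //; split=> // h y Uh SLh; rewrite FE.
Qed.

(** The chain rule for F: the velocity of an orbit curve depends on the curve in
    the group only through its velocity at the identity. *)
Lemma act_path U F m g A :
  smooth_extension U F -> U (1%:M, m) -> sl2_path g A ->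
  is_derive (0 : R) 1 (fun t => act (g t) m) ('D_(A, 0) F (1%:M, m)).
Proof.
move=> [oU sF FE] Um [SLg g0 Dg].
have Dp : is_derive (0 : R) 1 (fun t => (g t, m)) (A, 0).
  have D0 := is_derive_cst m (0 : R) 1.
  exact: (@is_derive_pair R 'M[R]_2 M g (cst m) 0 A 0 Dg D0).
have dF : differentiable F (g 0, m).
  by rewrite g0; exact: smooth_on_differentiable sF Um.
have D := @derive_along_curve R _ _ F (fun t => (g t, m)) 0 (A, 0) dF Dp.
rewrite /= g0 in D; apply: near_eq_is_derive D.
have : \forall t \near (0 : R), U (g t, m).
  by apply: curve_near Dp oU _; rewrite g0.
by apply: filterS => t Ut /=; rewrite FE.
Qed.

Lemma fund_fieldE U F m A : smooth_extension U F -> U (1%:M, m) -> \tr A = 0 ->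
  fund_field act A m = 'D_(- A, 0) F (1%:M, m).
Proof.
move=> ext Um trA; have [P _] := expmx_path trA.
by have [_] := act_path ext Um P.
Qed.

Lemma act_path_field m g A : \tr A = 0 -> sl2_path g (- A) ->
  is_derive (0 : R) 1 (fun t => act (g t) m) (fund_field act A m).
Proof.
move=> trA gA; have [U [F [ext Um]]] := exists_extension m SL2_1.
by rewrite (fund_fieldE ext Um)//; exact: act_path ext Um gA.
Qed.

Lemma fund_field_linear m c A B : \tr A = 0 -> \tr B = 0 ->
  fund_field act (c *: A + B) m = c *: fund_field act A m + fund_field act B m.
Proof.
move=> trA trB; have [U [F [ext Um]]] := exists_extension m SL2_1.
have trAB : \tr (c *: A + B) = 0 by rewrite linearP /= trA trB mulr0 addr0.
rewrite !(fund_fieldE ext Um)//; have [_ sF _] := ext.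
rewrite -derive_dir_linear; last exact: smooth_on_differentiable sF Um.
congr ('D__ F _); rewrite opprD -scalerN.
by rewrite -[RHS]/(c *: - A - B, c *: 0 + 0) scaler0 addr0.
Qed.

Lemma fund_field_smooth A : \tr A = 0 -> smooth_on setT (fund_field act A).
Proof.
move=> trA; apply: smooth_on_local => m _.
have [U [F [ext Um]]] := exists_extension m SL2_1.
have [oU sF FE] := ext.
exists [set y | U (1%:M, y)], (fun y => 'D_(- A, 0) F (1%:M, y)); split=> //.
- exact: open_slice.
- exact: smooth_on_slice (smooth_on_derive _ sF).
- by move=> y Uy; rewrite (fund_fieldE ext Uy).
Qed.

Lemma act_near U F g m : smooth_extension U F -> U (g, m) -> SL2 g ->
  \forall y \near m, F (g, y) = act g y.
Proof.
move=> [oU sF FE] Um SLg.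
have : \forall y \near m, U (g, y).
  by apply: open_nbhs_nbhs; split => //; exact: open_slice.
by apply: filterS => y Uy; rewrite FE.
Qed.

Lemma act_differentiable g m : SL2 g -> differentiable (act g) m.
Proof.
move=> SLg; have [U [F [ext Um]]] := exists_extension m SLg.
apply: near_eq_differentiable (act_near ext Um SLg) _.
have [_ sF _] := ext.
exact: smooth_on_differentiable (smooth_on_slice g sF) Um.
Qed.

Lemma derive_act U F g m v : smooth_extension U F -> U (g, m) -> SL2 g ->
  'D_v (act g) m = 'D_(0, v) F (g, m).
Proof.
move=> ext Um SLg; rewrite -derive_slice; apply: near_eq_derive.
by apply: filterS (act_near ext Um SLg) => y.
Qed.

Lemma act1 : act 1%:M = id.
Proof. by apply/funext => m; have [-> _ _] := actP. Qed.

(** Both sides are the velocity at t = 0 of the curve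
    g^-1 exp(- t A) g m. *)
Lemma fund_field_equivariant g m A : SL2 g -> \tr A = 0 ->
  'D_(fund_field act A (act g m)) (act (invmx g)) (act g m) =
  fund_field act (invmx g *m A *m g) m.
Proof.
move=> SLg trA; have SLV := SL2_inv SLg; have ug := SL2_unit SLg.
have [P _] := expmx_path trA.
have [SLe e0 _] := P.
have D := act_path_field (act g m) trA P.
pose c (t : R) := act (expmx (- (t *: A))) (act g m).
have dV : differentiable (act (invmx g)) (c 0) by exact: act_differentiable.
have [_ ] := @derive_along_curve _ _ _ _ c 0 _ dV D.
rewrite /c [in RHS]e0 act1 => <-.
have trC : \tr (invmx g *m A *m g) = 0.
  by rewrite mxtrace_mulC mulmxA mulmxV// mul1mx.
have [_ <-] := act_path_field m trC (conj_path SLg trA).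
congr ('D__ _ _); apply/funext => t /=; have [_ actM _] := actP.
by rewrite -!actM//; rewrite /SL2 /= !det_mulmx ?SLV ?SLg ?(SLe t) !mulr1.
Qed.

End Action.

(** * The vector fields of the cotangent lift *)

Section Lift.
Context {R : realType} (act : 'M[R]_2 -> 'rV[R]_3 -> 'rV[R]_3).
Hypothesis actP : lie_group_action act.

Lemma fund_field_differentiable A m : \tr A = 0 ->
  differentiable (fund_field act A) m.
Proof.
by move=> trA; exact: smooth_on_differentiable (fund_field_smooth actP trA) _.
Qed.

(** With c t = (exp(t A), exp(- t A) m) and G the derivative of an extension F
    along e in R^3, the function is G (c t) for small t.  Its derivative at 0
    is the sum of two terms.  Along R^3, G (1, z) = e is constant and
    contributes 0; along the group, symmetry of second derivatives turns
    D_A D_e F into D_e D_A F = - D_e (fund_field act A). *)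
Lemma derive_inverse_action m A e : \tr A = 0 ->
  is_derive (0 : R) 1
    (fun t => 'D_e (act (invmx (expmx (- (t *: A)))))
                   (act (expmx (- (t *: A))) m))
    (- 'D_e (fund_field act A) m).
Proof.
move=> trA; have [P [SLV V0 DV]] := expmx_path trA.
have DX := act_path_field actP m trA P; have [SLe e0 De] := P.
have [U [F [ext Um]]] := exists_extension actP m SL2_1.
have [oU sF FE] := ext.
set X := fund_field act A in DX *.
pose G := 'D_(0, e) F.
pose c t := (invmx (expmx (- (t *: A))), act (expmx (- (t *: A))) m).
have Dc : is_derive (0 : R) 1 c (A, X m) by exact: is_derive_pair DV DX.
have c0 : c 0 = (1%:M, m) by rewrite /c V0 e0 (act1 actP).
have dG y : U y -> differentiable G y.
  by move=> Uy; exact: smooth_on_differentiable (smooth_on_derive _ sF) Uy.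
have dGc : differentiable G (c 0) by rewrite c0; exact: dG.
have D := @derive_along_curve R _ _ G c 0 (A, X m) dGc Dc.
have Uc : \forall t \near (0 : R), U (c t).
  by apply: curve_near Dc oU _; rewrite c0.
pose H t := 'D_e (act (c t).1) (c t).2.
have D' := @near_eq_is_derive _ _ _ (G \o c) H 0 1 _ _ D.
apply: is_derive_eq (D' _) _.
  by apply: filterS Uc => t Ut; rewrite /H (derive_act _ ext Ut).
rewrite c0 (pair_split A (X m)) derive_dir_linear ?scale1r; last exact: dG.
have nU : \forall z \near m, U (1%:M, z).
  by apply: open_nbhs_nbhs; split => //; exact: open_slice.
have -> : 'D_(0, X m) G (1%:M, m) = 0.
  rewrite -derive_slice -[RHS](derive_cst e m (X m)); apply: near_eq_derive.
  apply: filterS nU => z Uz.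
  by rewrite /G -(derive_act _ ext Uz SL2_1) (act1 actP) derive_id.
rewrite addr0.
apply: etrans (derive_comm_mx (A, 0) (0, e) oU Um sF) _.
rewrite -derive_slice -deriveN; last first.
  exact/diff_derivable/fund_field_differentiable.
apply: near_eq_derive; apply: filterS nU => z Uz.
rewrite /X fctE (fund_fieldE ext Uz)//.
have dF := smooth_on_differentiable sF Uz.
rewrite -[LHS]opprK; congr (- _); rewrite !deriveE// -linearN; congr ('d _ _ _).
by rewrite -[LHS]/(- A, - 0) oppr0.
Qed.

Lemma is_derive_lift A (b : cotangent R) : \tr A = 0 ->
  is_derive (0 : R) 1 (fun t => cotangent_lift act (expmx (- (t *: A))) b)
    (fund_field act A b.1,
     \row_i - pairing b.2 ('D_(delta_mx 0 i) (fund_field act A) b.1)).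
Proof.
move=> trA; have [P _] := expmx_path trA.
apply: is_derive_pair; first exact: act_path_field.
apply: is_derive_row => i.
have D := is_derive_pairing (is_derive_cst b.2 (0 : R) 1)
  (derive_inverse_action b.1 (delta_mx 0 i) trA).
apply: is_derive_eq D _.
by rewrite pairing0l add0r pairingNr.
Qed.

Lemma fund_field_lift A (b : cotangent R) : \tr A = 0 ->
  fund_field (cotangent_lift act) A b =
    (fund_field act A b.1,
     \row_i - pairing b.2 ('D_(delta_mx 0 i) (fund_field act A) b.1)).
Proof. by move=> trA; have [_] := is_derive_lift b trA. Qed.

End Lift.

(** * The moment map *)

Section MomentMap.
Context {R : realType} (act : 'M[R]_2 -> 'rV[R]_3 -> 'rV[R]_3).
Hypothesis actP : lie_group_action act.

Lemma liouvilleE (b v : cotangent R) : liouville b v = pairing b.2 v.1.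
Proof.
rewrite /liouville (@derive_linear R _ _ fst)//; exact: fst_continuous.
Qed.

Lemma omegaE (b u v : cotangent R) :
  omega b u v = pairing u.2 v.1 - pairing v.2 u.1.
Proof.
have D (w w' : cotangent R) :
    'D_w (fun y : cotangent R => liouville y w') b = pairing w.2 w'.1.
  under eq_fun do rewrite liouvilleE.
  have [_ ->] :=
    is_derive_pairing (is_derive_snd b w) (is_derive_cst w'.1 b w).
  by rewrite /cst [X in _ + X]big1 ?addr0// => i _; rewrite !mxE mulr0.
rewrite /omega /ext_d.
have Du := D u v.
have Dv := D v u.
by congr (_ - _); [exact: Du|exact: Dv].
Qed.

Definition momentum (b : cotangent R) (A : 'M[R]_2) : R :=
  - pairing b.2 (fund_field act A b.1).

Lemma fund_field_fst A (c : cotangent R) :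
  fund_field act A c.1 = fund_field act A (0 + fst c).
Proof. by rewrite add0r. Qed.

Lemma momentum_derive (b v : cotangent R) A : \tr A = 0 ->
  'D_v (fun c => momentum c A) b =
  - (pairing v.2 (fund_field act A b.1) +
     pairing b.2 ('D_(v.1) (fund_field act A) b.1)).
Proof.
move=> trA.
have Df : is_derive b v (fun c : cotangent R => fund_field act A c.1)
    ('D_(v.1) (fund_field act A) b.1).
  split.
    apply/diff_derivable/(@differentiable_comp _ _ _ _ fst).
      by apply: linear_differentiable; exact: fst_continuous.
    exact: fund_field_differentiable.
  under eq_fun do rewrite fund_field_fst.
  by rewrite (derive_affine _ fst 0) add0r.
by have [_ ->] := is_deriveN (is_derive_pairing (is_derive_snd b v) Df).
Qed.

Lemma momentum_smooth A : \tr A = 0 -> smooth_on setT (fun b => momentum b A).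
Proof.
move=> trA.
have -> : (fun b => momentum b A) =
    (fun b : cotangent R => \sum_i (-1 * b.2 0 i) * fund_field act A b.1 0 i).
  apply/funext => b; rewrite /momentum /pairing -sumrN.
  by apply: eq_bigr => i _; rewrite mulN1r mulNr.
apply: smooth_on_sum; first exact: openT.
move=> i; apply: smooth_onM; first exact: openT.
  apply: smooth_onM; first exact: openT.
    by move=> k; exact: Ck_on_cst.
  apply: (smooth_on_coord 0 i (f := snd)); first exact: openT.
  exact: (smooth_on_linear _ (@snd_continuous _ _ _)).
apply: (smooth_on_coord 0 i (f := fun b => fund_field act A b.1)).
  exact: openT.
under [X in smooth_on _ X]eq_fun do rewrite fund_field_fst.
have sX := fund_field_smooth actP trA.
exact: (smooth_on_affine 0 (@fst_continuous _ _ _) sX).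
Qed.

Lemma momentum_is_moment_map : moment_map (cotangent_lift act) momentum.
Proof.
split.
- move=> b c xi eta; rewrite !sl2P => /eqP txi /eqP teta.
  rewrite /momentum (fund_field_linear actP _ _ txi teta) pairing_linear.
  rewrite opprD mulrN; reflexivity.
- by move=> xi; rewrite sl2P => /eqP; exact: momentum_smooth.
- move=> xi; rewrite sl2P => /eqP txi b v.
  rewrite (momentum_derive _ _ txi) omegaE (fund_field_lift actP _ txi).
  rewrite opprD addrC; congr (_ + _).
  rewrite pairing_rowN pairing_derive//.
  exact: fund_field_differentiable.
- move=> g SLg b xi; rewrite sl2P => /eqP txi.
  rewrite /momentum /cotangent_lift /pullback /= pairing_derive; last first.
    exact: act_differentiable (SL2_inv SLg).
  by rewrite fund_field_equivariant.
Qed.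

End MomentMap.

(** * The zeros of the perturbed vector field *)

Section VectorField.
Context {R : realType} (a : R -> R).

Lemma vec3E (x y z : R) :
  [/\ coord_x (vec3 x y z) = x, coord_y (vec3 x y z) = y
    & coord_z (vec3 x y z) = z].
Proof. by rewrite /coord_x /coord_y /coord_z !mxE !inordK. Qed.

(** On the x-axis the linear field vanishes, r^2 = t^2 and z = 0, so that only
    f R = (a(t^2) / t) (t, 0, 0) remains.  At t = 0, where f is 0 by
    convention, the formula needs a(0) = 0. *)
Lemma Xbar_axis (t : R) : a 0 = 0 ->
  Xbar a (t *: vec3 1 0 0) = a (t ^+ 2) *: vec3 1 0 0.
Proof.
move=> a0.
have -> : t *: vec3 1 0 0 = vec3 t 0 0 :> 'rV[R]_3.
  apply/rowP => i; rewrite !mxE.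
  by case: i => -[|[|[|]]]//= _; rewrite ?mulr1 ?mulr0.
have [cx cy cz] := vec3E t 0 0.
have r2 : Defs.radius (vec3 t 0 0) ^+ 2 = t ^+ 2.
  by rewrite /Defs.radius cx cy expr0n addr0 sqr_sqrtr// sqr_ge0.
have fE : fcoef a (vec3 t 0 0) * t = a (t ^+ 2).
  rewrite /fcoef /Acoef cx cz r2 expr0n subr0.
  have r0 : (Defs.radius (vec3 t 0 0) == 0) = (t == 0).
    by rewrite -sqrf_eq0 r2 sqrf_eq0.
  rewrite r0; case: eqP => [->|/eqP t0]; first by rewrite mul0r expr0n a0.
  by field.
rewrite /Xbar /rhoX /radial cx cy cz; apply/rowP => i; rewrite !mxE.
by case: i => -[|[|[|]]]//= _; rewrite ?mulr1 ?mulr0 ?addr0 ?add0r ?fE.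
Qed.

(** The x-component is x^2 a(r^2 - z^2) / r^2, where
    r^2 - z^2 >= x^2 - z^2 > 0. *)
Lemma Xbar_neq0 (q : 'rV[R]_3) : (forall s, 0 < s -> a s != 0) ->
  `|coord_z q| < `|coord_x q| -> Xbar a q != 0.
Proof.
move=> a_pos zx.
have x0 : coord_x q != 0 by rewrite -normr_gt0 (le_lt_trans _ zx).
apply/eqP => /(congr1 (@coord_x R)).
have r2 : Defs.radius q ^+ 2 = coord_x q ^+ 2 + coord_y q ^+ 2.
  by rewrite /Defs.radius sqr_sqrtr// addr_ge0// sqr_ge0.
have r2pos : 0 < Defs.radius q ^+ 2.
  by rewrite r2 ltr_pwDl ?sqr_ge0// exprn_even_gt0.
have rn0 : Defs.radius q != 0 by rewrite -sqrf_eq0 gt_eqF.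
have pos : 0 < Defs.radius q ^+ 2 - coord_z q ^+ 2.
  rewrite subr_gt0 r2 (@lt_le_trans _ _ (coord_x q ^+ 2))//.
    rewrite -(real_normK (num_real (coord_z q))).
    by rewrite -(real_normK (num_real (coord_x q))) ltrXn2r.
  by rewrite lerDl sqr_ge0.
have [+ _ _] := vec3E 0 (coord_z q) (coord_y q).
have [+ _ _] := vec3E (coord_x q) (coord_y q) (coord_z q).
rewrite /Xbar /rhoX /radial /coord_x => e1 e2; rewrite !mxE /= in e1 e2 *.
rewrite e1 e2 add0r /fcoef (negPf rn0) /Acoef => /eqP.
rewrite !mulf_eq0 invr_eq0 (negPf x0) expf_eq0 (negPf rn0).
by rewrite (negPf (a_pos _ pos)).
Qed.

End VectorField.

Section Derivatives.
Context {R : realType}.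

Lemma is_derive_mulmx_coord m n p (f : R -> 'M[R]_(m, n)) df (t : R)
    (L : 'M[R]_(n, p)) i j :
  is_derive t 1 f df ->
  is_derive t 1 (fun s => (f s *m L) i j) ((df *m L) i j).
Proof.
move=> Df.
have D k := is_deriveZ (L k j) (is_derive_coord i k Df).
have -> : (fun s => (f s *m L) i j) =
    \sum_(k < n) (fun s => L k j *: f s i k).
  apply/funext => s; rewrite fct_sumE mxE.
  by apply: eq_bigr => k _; rewrite mulrC.
apply: is_derive_eq (is_derive_sum D) _.
by rewrite mxE; apply: eq_bigr => k _; rewrite mulrC.
Qed.

Lemma derive_quotient_near (f : R -> R) df :
  is_derive (0 : R) 1 f df -> f 0 = 0 ->
  forall e, 0 < e -> \forall t \near (0 : R)^', `|df - t^-1 * f t| < e.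
Proof.
move=> [d <-] f0 e e0.
have := d; rewrite /derivable => /cvgrPdist_lt /(_ e e0).
apply: filterS => t; rewrite /derive /=.
by rewrite f0 subr0 addr0 [_ *: 1]mulr1.
Qed.

End Derivatives.

(** * Zeros of a linearizable vector field *)

Section ZeroCurve.
Context {R : realType}.
Implicit Types (U : set (cotangent R)) (phi : cotangent R -> 'rV[R]_6).

(** A vector field that is linear in some coordinates and vanishes to second
    order along the direction e vanishes on a curve tangent to e.  In the
    coordinates, the values phi(0) and w = D_e phi(0) are killed by L: the first
    because the field is zero at 0, the second because
    phi(t e) L = k(t) D_e phi(t e) has derivative 0 at t = 0.  So the field is
    zero along t |-> phi(0) + t w, whose preimage has velocity e. *)
Lemma zero_curve U phi (v : cotangent R -> cotangent R) L e (k : R -> R) :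
  local_coordinates 0 U phi ->
  (forall x, U x -> 'D_(v x) phi x = phi x *m L) ->
  (forall t : R, v (t *: e) = k t *: e) -> k 0 = 0 -> is_derive (0 : R) 1 k 0 ->
  exists x : R -> cotangent R,
    [/\ x 0 = 0, is_derive (0 : R) 1 x e
      & \forall t \near (0 : R), v (x t) = 0].
Proof.
move=> [oU U0 sphi [W [psi [oW spsi UW WU]]]] lin vE k0 Dk.
have dphi x : U x -> differentiable phi x.
  exact: smooth_on_differentiable sphi.
have dpsi y : W y -> differentiable psi y.
  exact: smooth_on_differentiable spsi.
(* The differential of psi inverts that of phi. *)
have psi_phi x u : U x -> 'D_('D_u phi x) psi (phi x) = u.
  move=> Ux; have [Wx _] := UW _ Ux.
  rewrite [LHS]deriveE ?deriveE//; [|exact: dphi|exact: dpsi].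
  rewrite -[LHS]/(('d psi (phi x) \o 'd phi x) u) -diff_comp;
    [|exact: dphi|exact: dpsi].
  rewrite -deriveE; last first.
    by apply: differentiable_comp; [exact: dphi|exact: dpsi].
  rewrite -[RHS](derive_id x u); apply: near_eq_derive.
  have nU : \forall y \near x, U y by exact: open_nbhs_nbhs.
  by apply: filterS nU => y Uy; have [_] := UW _ Uy.
have De : is_derive (0 : R) 1 (fun t : R => t *: e) e.
  by have := is_derive_scalel e (is_derive_id (0 : R) 1); rewrite scale1r.
pose w := 'D_e phi 0.
have e0 : (0 : R) *: e = 0 by rewrite scale0r.
have dphi0 : differentiable phi ((0 : R) *: e) by rewrite e0; exact: dphi.
have Dphi := @derive_along_curve R _ _ phi (fun t => t *: e) 0 e dphi0 De.
rewrite /= e0 -/w in Dphi.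
have Ue : \forall t \near (0 : R), U (t *: e).
  by apply: curve_near De oU _; rewrite e0.
have linE t : U (t *: e) -> phi (t *: e) *m L = k t *: 'D_e phi (t *: e).
  move=> Ut; rewrite -lin// vE -[k t *: e]addr0.
  by rewrite derive_dir_linear ?derive0 ?addr0//; exact: dphi.
have phi0L : phi 0 *m L = 0.
  by rewrite -e0 linE e0 ?k0 ?scale0r.
have wL : w *m L = 0.
  apply/rowP => j; rewrite [RHS]mxE.
  have [_ <-] := is_derive_mulmx_coord L 0 j Dphi.
  have dG : differentiable ('D_e phi) ((0 : R) *: e).
    rewrite e0.
    exact: smooth_on_differentiable (smooth_on_derive e sphi) U0.
  have DG := @derive_along_curve R _ _ ('D_e phi) (fun t => t *: e) 0 e dG De.
  have [_ D0] := is_deriveM Dk (is_derive_coord 0 j DG).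
  rewrite k0 scale0r scaler0 addr0 in D0; rewrite -[RHS]D0.
  apply: near_eq_derive; apply: filterS Ue => t Ut /=.
  by rewrite linE// mxE.
pose y t := phi 0 + t *: w.
have [W0 psi0] := UW _ U0.
have Dy : is_derive (0 : R) 1 y w by exact: is_derive_line.
have y0 : y 0 = phi 0 by rewrite /y scale0r addr0.
have Wy : \forall t \near (0 : R), W (y t).
  by apply: curve_near Dy oW _; rewrite y0.
exists (psi \o y); split.
- by rewrite /= y0.
- have dy : differentiable psi (y 0) by rewrite y0; exact: dpsi.
  apply: is_derive_eq (derive_along_curve dy Dy) _.
  by rewrite y0 /w psi_phi.
- apply: filterS Wy => t Wyt; have [Ux phix] := WU _ Wyt.
  have yL : y t *m L = 0.
    by rewrite /y mulmxDl phi0L -scalemxAl wL scaler0 addr0.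
  by rewrite -(psi_phi _ (v (psi (y t))) Ux) lin// phix yL derive0.
Qed.

End ZeroCurve.

Section NonLinearizable.
Context {R : realType} (act : 'M[R]_2 -> 'rV[R]_3 -> 'rV[R]_3).

(** [zero_curve] applies with e the x-axis of the zero section and
    k(t) = a(t^2). *)
Lemma lift_not_linearizable (a : R -> R) (X : 'M[R]_2) :
  lie_group_action act -> \tr X = 0 ->
  (forall q, fund_field act X q = Xbar a q) ->
  a 0 = 0 -> differentiable a 0 -> (forall s, 0 < s -> a s != 0) ->
  ~ smoothly_linearizable (cotangent_lift act) (0 : cotangent R).
Proof.
move=> actP trX XE a0 da a_pos [U [phi [coord lin]]].
have [L linL] : exists L : 'M[R]_6, forall x, U x ->
    'D_(fund_field (cotangent_lift act) X x) phi x = phi x *m L.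
  by apply: lin; rewrite sl2P trX.
have vE (t : R) : fund_field (cotangent_lift act) X (t *: (vec3 1 0 0, 0)) =
    a (t ^+ 2) *: ((vec3 1 0 0, 0) : cotangent R).
  rewrite fund_field_lift//= XE Xbar_axis//; congr (_, _).
  by apply/rowP => i; rewrite !mxE scaler0 pairing0l oppr0 mulr0.
have Dk : is_derive (0 : R) 1 (fun t => a (t ^+ 2)) 0.
  have da0 : differentiable a ((fun t => t ^+ 2) (0 : R)) by rewrite /= expr0n.
  have D2 : is_derive (0 : R) 1 (fun t => t ^+ 2) 0.
    have Di := is_derive_id (0 : R) 1.
    by apply: is_derive_eq (is_deriveM Di Di) _; rewrite scale0r addr0.
  have D := @derive_along_curve R R R a (fun t => t ^+ 2) 0 0 da0 D2.
  apply: is_derive_eq D _.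
  by rewrite derive0.
have k0 : a (0 ^+ 2) = 0 by rewrite expr0n.
have [x [x0 Dx x_zero]] := zero_curve coord linL vE k0 Dk.
have Dq : is_derive (0 : R) 1 (fst \o x) (vec3 1 0 0).
  have dfst : differentiable (fst : cotangent R -> 'rV[R]_3) (x 0).
    by apply: linear_differentiable; exact: fst_continuous.
  apply: is_derive_eq (derive_along_curve dfst Dx) _.
  by have [_ ->] := is_derive_fst (x 0) (vec3 1 0 0, 0).
have [cx _ cz] := @vec3E R 1 0 0.
have Dqx := is_derive_coord 0 (inord 0) Dq; rewrite -/(coord_x _) cx in Dqx.
have Dqz := is_derive_coord 0 (inord 2) Dq; rewrite -/(coord_z _) cz in Dqz.
have q0 i : (x 0).1 0 i = 0 by rewrite x0 mxE.
(* The zeros x(t) have base points (t + o(t), o(t), o(t)); for small t <> 0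
   this gives |z / t| < 1/2 < |x / t|. *)
have half : 0 < 2^-1 :> R by rewrite invr_gt0.
have nx := derive_quotient_near Dqx (q0 _) half.
have nz := derive_quotient_near Dqz (q0 _) half.
have n0 : \forall t \near (0 : R)^',
    fund_field (cotangent_lift act) X (x t) = 0.
  exact: cvg_within x_zero.
have nt : \forall t \near (0 : R)^', t != 0 by exact: nbhs_dnbhs_neq.
have [t [[tx tz] [vt t0]]] :=
  filter_ex (filterI (filterI nx nz) (filterI n0 nt)).
have : Xbar a (x t).1 = 0.
  by rewrite -XE; have := vt; rewrite fund_field_lift// => /(congr1 fst).
apply/eqP; apply: Xbar_neq0 => //.
have tn0 : 0 < `|t^-1| by rewrite normr_gt0 invr_neq0.
rewrite -(ltr_pM2l tn0) -!normrM (@lt_trans _ _ 2^-1)//.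
  by rewrite sub0r normrN in tz.
have := ler_normD (1 - t^-1 * coord_x (x t).1) (t^-1 * coord_x (x t).1).
by rewrite subrK normr1; move: tx; rewrite /coord_x /=; lra.
Qed.

End NonLinearizable.

Theorem proposition3p2 (R : realType) (a : R -> R)
    (a_smooth : smooth_on [set: R] a)
    (a_bounded : exists B : R, forall s, `|a s| <= B)
    (a_neg : forall s, s <= 0 -> a s = 0)
    (a_pos : forall s, 0 < s -> a s != 0)
    (X Y Z : 'M[R]_2) (XYZ_basis : sl2_basis X Y Z)
    (alpha : 'M[R]_2 -> 'rV[R]_3 -> 'rV[R]_3)
    (alpha_action : lie_group_action alpha)
    (alpha_X : forall q, fund_field alpha X q = Xbar a q)
    (alpha_Y : forall q, fund_field alpha Y q = Ybar a q)
    (alpha_Z : forall q, fund_field alpha Z q = Zbar q) :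
  hamiltonian (cotangent_lift alpha) /\
  ~ smoothly_linearizable (cotangent_lift alpha) (0 : cotangent R).
Proof.
split; first by exists (momentum alpha); exact: momentum_is_moment_map.
have trX : \tr X = 0.
  have [basis _ _ _] := XYZ_basis.
  by apply/eqP; rewrite -sl2P (basis_mem basis)// mem_head.
apply: (lift_not_linearizable (a := a) (X := X)) => //; first exact: a_neg.
exact: smooth_on_differentiable a_smooth _.
Qed.
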